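(* Let $ABCD$ be a parallelogram with center $O$ (the intersection of its diagonals), and let $f\colon ABCD\to\mathbb{R}$ be a function whose restrictions to the triangles $AOB$, $BOC$, $COD$ and $DOA$ are convex. Then $$\operatorname{Avg}(f,ABCD)\le\frac13\cdot\frac{f(A)+f(B)+f(C)+f(D)}{4}+\frac23\cdot\frac{\operatorname{Avg}(f,AC)+\operatorname{Avg}(f,BD)}{2}.$$
   Context: For a set $U$ which is a $k$-dimensional object (segment, polygon) and an integrable $f$, $\operatorname{Avg}(f,U)=\frac{1}{\operatorname{Vol}_k(U)}\int_U f$, with $\operatorname{Vol}_k$ the $k$-dimensional measure (length, area). For points $X,Y,\dots$, $\operatorname{Avg}(f,XY\dots)$ means $\operatorname{Avg}(f,\operatorname{conv}\{X,Y,\dots\})$. *)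

(* Defs.v *)
From HB Require Import structures.
From mathcomp Require Import all_boot all_order all_algebra.
From mathcomp Require Import all_classical all_reals all_analysis.
Set Implicit Arguments. Unset Strict Implicit. Unset Printing Implicit Defensive.
Import Order.TTheory GRing.Theory Num.Theory.
Local Open Scope classical_set_scope.
Local Open Scope ring_scope.

Section Defs.
Variable R : realType.
Notation P := (R * R)%type.

Definition conv3 (A B C : P) : set P :=
  [set x | exists a b c : R, [/\ 0 <= a, 0 <= b, 0 <= c, a + b + c = 1 &
     x = a *: A + b *: B + c *: C]].

Definition conv4 (A B C D : P) : set P :=
  [set x | exists a b c d : R, [/\ 0 <= a, 0 <= b, 0 <= c, 0 <= d &
     a + b + c + d = 1] /\ x = a *: A + b *: B + c *: C + d *: D].

Definition leb2 := (@lebesgue_measure R \x @lebesgue_measure R)%E.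

Definition Avg2 (f : P -> R) (U : set P) : R :=
  (\int[leb2]_(x in U) f x) / fine (leb2 U).

(* Avg(f, XY) over the segment [X,Y]: the arc-length average, i.e.
   (1/|XY|) \int_{XY} f ds = \int_0^1 f(X + t (Y - X)) dt *)
Definition AvgSeg (f : P -> R) (X Y : P) : R :=
  \int[@lebesgue_measure R]_(t in `[0, 1]) f (X + t *: (Y - X)).

Definition convex_on (S : set P) (f : P -> R) : Prop :=
  forall (x y : P) (t : R), S x -> S y -> 0 <= t <= 1 ->
    f (t *: x + (1 - t) *: y) <= t * f x + (1 - t) * f y.

Definition parallelogram (A B C D : P) : Prop :=
  A + C = B + D /\
  (B.1 - A.1) * (D.2 - A.2) - (B.2 - A.2) * (D.1 - A.1) != 0.

End Defs.

(* Main.v *)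
(* Write [O] for the centre, [U = A - O], [V = B - O]. On the segment of triangle
   [AOB] parallel to [AB] through [O + s U] and [O + s V], convexity bounds [f]
   by the linear interpolation of its values on the half-diagonals. Integrating
   this bound over the triangle leaves the moments [int_0^1 s g(s) ds] of the
   restrictions [g] of [f] to the half-diagonals. For convex [g], the line [l]
   through [(1/3, g(1/3))] and [(1, g 1)] satisfies
   [(s - 1/3) g(s) <= (s - 1/3) l(s)] on [[0, 1]], whence
   [int_0^1 s g <= g(1)/6 + 1/3 int_0^1 g], and summing over the four
   half-diagonals gives the claim. The integral of [f] is compared with that of a
   Borel majorant built from the restrictions to the half-diagonals, so that the
   measurability of [f] in the plane never has to be established. *)
Require Import Defs.
From HB Require Import structures.
From mathcomp Require Import all_boot all_order all_algebra.
From mathcomp Require Import all_classical all_reals all_analysis.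
From mathcomp Require Import measurable_realfun ring lra.
Import Order.TTheory GRing.Theory Num.Theory numFieldNormedType.Exports.
Local Open Scope classical_set_scope.
Local Open Scope ring_scope.

(** * Affine changes of variables on the line and in the plane *)

Section affine_substitution.
Context {R : realType}.
Notation mu := (@lebesgue_measure R).

Lemma measurable_affine (a b : R) :
  measurable_fun setT (fun x : measurableTypeR R => a * x + b : measurableTypeR R).
Proof.
by apply: measurable_funD; [exact: mulrl_measurable|exact: measurable_cst].
Qed.

(** Lebesgue measure is determined by its values on the half-open intervals []x, y]], so it suffices
    to compare lengths there. For [a < 0] the preimage is closed on the left and open on the right,
    which leaves its length unchanged. *)
Lemma lebesgue_measure_affine (a b : R) (A : set (measurableTypeR R)) :
    a != 0 -> measurable A ->
  (`|a|%:E * mu ((fun x => a * x + b)%R @^-1` A) = mu A)%E.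
Proof.
move=> a0 mA.
have a0' : 0 <= `|a| by [].
have mf := measurable_affine a b.
pose nu : {measure set (measurableTypeR R) -> \bar R} := mscale (NngNum a0')
  (pushforward mu (fun x : measurableTypeR R => a * x + b : measurableTypeR R)).
rewrite [RHS](@lebesgue_measure_unique _ (nu mf) _ A mA)// => _ [[x y]] _ <-.
rewrite /nu/= /mscale/= /pushforward/=.
have [xy|yx] := ltP x y; last first.
  by rewrite set_itv_ge ?bnd_simp -?leNgt// preimage_set0 !measure0 mule0.
have [a_gt0|a_lt0|/eqP] := ltgtP 0 a; last by rewrite eq_sym (negbTE a0).
- rewrite (_ : _ @^-1` _ = `](x - b) / a, (y - b) / a]%classic); last first.
    apply/seteqP; split => t /=;
    by rewrite !in_itv/= ltr_pdivrMr// ler_pdivlMr// (mulrC t) ltrBlDr lerBrDr.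
  rewrite !lebesgue_measure_itv/= !lte_fin ltr_pM2r ?invr_gt0// ltrD2r xy.
  by rewrite -!EFinB -EFinM gtr0_norm//; congr EFin; field; rewrite gt_eqF.
- rewrite (_ : _ @^-1` _ = `[(y - b) / a, (x - b) / a[%classic); last first.
    apply/seteqP; split => t /=;
    by rewrite !in_itv/= ltr_ndivlMr// ler_ndivrMr// (mulrC t) ltrBlDr lerBrDr andbC.
  rewrite !lebesgue_measure_itv/= !lte_fin ltr_nM2r ?invr_lt0// ltrD2r xy.
  by rewrite -!EFinB -EFinM ltr0_norm//; congr EFin; field; rewrite lt_eqF.
Qed.

Lemma ge0_integral_affine (a b : R) (h : R -> \bar R) :
    a != 0 -> measurable_fun setT h -> (forall x, 0 <= h x)%E ->
  (\int[mu]_x h (a * x + b)%R = `|a|^-1%:E * \int[mu]_x h x)%E.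
Proof.
move=> a0 mh h0.
have a0' : 0 <= `|a| by [].
have mf := measurable_affine a b.
pose nu : {measure set (measurableTypeR R) -> \bar R} := mscale (NngNum a0')
  (pushforward mu (fun x : measurableTypeR R => a * x + b : measurableTypeR R)).
rewrite [in RHS](eq_measure_integral (nu mf)); last first.
  by move=> A mA _; exact/esym/lebesgue_measure_affine.
rewrite ge0_integral_mscale//= ge0_integral_pushforward//=.
by rewrite preimage_setT muleA -EFinM mulVf ?normr_eq0// mul1e.
Qed.

Notation mu2 := (@leb2 R).

(** Tonelli's theorem reduces this to two substitutions on the line: Gaussian elimination factors
    the linear part into maps that change one variable at a time. *)
Lemma ge0_integral_affine2 (a b c d e e' : R) (G : R * R -> \bar R) :
    a * d - b * c != 0 -> measurable_fun setT G -> (forall z, 0 <= G z)%E ->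
  (\int[mu2]_z G (a * z.1 + b * z.2 + e, c * z.1 + d * z.2 + e')%R =
   `|a * d - b * c|^-1%:E * \int[mu2]_z G z)%E.
Proof.
move=> D0 mG G0.
have mX : measurable_fun setT (fst : R * R -> R) by exact: measurable_fst.
have mY : measurable_fun setT (snd : R * R -> R) by exact: measurable_snd.
have mL (u v w : R) : measurable_fun setT
    (fun z : R * R => u * z.1 + v * z.2 + w).
  apply: measurable_funD; last exact: measurable_cst.
  by apply: measurable_funD; apply: measurable_funM => //; exact: measurable_cst.
have mGL u v w u' v' w' : measurable_fun setT
    (fun z : R * R =>
       G (u * z.1 + v * z.2 + w, u' * z.1 + v' * z.2 + w')).
  by apply: (measurableT_comp mG); exact: (measurable_fun_pair (mL _ _ _) (mL _ _ _)).
rewrite fubini_tonelli2//; last exact: mGL.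
rewrite /fubini_G/=.
(* A vanishing pivot: the first coordinate then depends on [y] alone, so the inner substitution is
   made in the second coordinate, with factor [c], and the outer one in the first, with factor
   [b]. *)
have [a0|a0] := eqVneq a 0.
  have b0 : b != 0 by apply: contraNneq D0 => ->; rewrite a0 !mul0r subrr.
  have c0 : c != 0 by apply: contraNneq D0 => ->; rewrite a0 mulr0 mul0r subrr.
  transitivity (\int[mu]_y (`|c|^-1%:E * \int[mu]_x G ((b * y + e)%R, x)))%E.
    apply: eq_integral => y _.
    rewrite -(@ge0_integral_affine c (d * y + e'))//; last first.
      exact: measurableT_comp mG _.
    by apply: eq_integral => x _; rewrite a0 mul0r add0r addrA.
  have mF : measurable_fun setT (fun y => \int[mu]_x G (y, x))%E.
    by apply: (@measurable_fun_fubini_tonelli_F _ _ _ _ R mu _ mG).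
  rewrite ge0_integralZl_EFin//; last 2 first.
  - by move=> y _; exact: integral_ge0.
  - by apply: (measurableT_comp mF); exact: measurable_affine.
  rewrite (@ge0_integral_affine b e (fun y => \int[mu]_x G (y, x))%E)//; last first.
    by move=> y; exact: integral_ge0.
  rewrite [in RHS]fubini_tonelli1// muleA -EFinM a0 mul0r sub0r normrN normrM invfM.
  by rewrite mulrC.
(* [D] is the Schur complement of [a]. Once [a x + b y + e] is the new first variable, the second
   coordinate reads [c / a * x + D * y + e2]. *)
pose D := (d - c * b / a)%R.
have DE : (a * d - b * c = a * D)%R by rewrite /D; field.
have D1 : D != 0 by apply: contraNneq D0; rewrite DE => ->; rewrite mulr0.
pose e2 := (e' - c / a * e)%R.
transitivity (\int[mu]_y (`|a|^-1%:E * \int[mu]_x G (x, (c / a * x + D * y + e2)%R)))%E.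
  apply: eq_integral => y _.
  rewrite -(@ge0_integral_affine a (b * y + e) (fun x => G (x, (c / a * x + D * y + e2)%R)))//.
    apply: eq_integral => x _; congr (G (_, _)); first by rewrite addrA.
    by rewrite /D /e2; field.
  have := mGL 1 0 0 (c / a) D e2.
  move=> /measurable_fun_pair1 => /(_ y).
  by congr (measurable_fun _ _); apply/funext => x /=; rewrite mul1r mul0r !addr0.
have mH : measurable_fun setT (fun z : R * R =>
    G (z.1, (c / a * z.1 + D * z.2 + e2)%R)).
  have := mGL 1 0 0 (c / a) D e2.
  by congr (measurable_fun _ _); apply/funext => x /=; rewrite mul1r mul0r !addr0.
rewrite ge0_integralZl_EFin//; last 2 first.
- by move=> y _; exact: integral_ge0.
- by apply: (@measurable_fun_fubini_tonelli_G _ _ _ _ R mu _ mH).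
rewrite -[X in (_ * X)%E](@fubini_tonelli _ _ _ _ R mu mu _ mH)//=.
transitivity (`|a|^-1%:E * \int[mu]_x (`|D|^-1%:E * \int[mu]_y G (x, y)))%E.
  congr (_ * _)%E; apply: eq_integral => x _.
  rewrite -(@ge0_integral_affine D (c / a * x + e2) (fun y => G (x, y)))//; last first.
    exact: measurableT_comp mG _.
  by apply: eq_integral => y _; congr (G (_, _)); ring.
rewrite ge0_integralZl_EFin//; last 2 first.
- by move=> y _; exact: integral_ge0.
  by apply: (@measurable_fun_fubini_tonelli_F _ _ _ _ R mu _ mG).
by rewrite [in RHS]fubini_tonelli1// muleA -EFinM DE normrM invfM.
Qed.

End affine_substitution.

(** * The tent function and its integral along the unfolding *)

Section tent.
Context {R : realType}.
Notation mu := (@lebesgue_measure R).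
Notation mu2 := (@leb2 R).

Lemma integral_deriv_poly (p : {poly R}) (a b : R) : a < b ->
  (\int[mu]_(x in `[a, b]) (p^`().[x])%:E = (p.[b] - p.[a])%:E)%E.
Proof.
move=> ab; rewrite EFinB; apply: (@continuous_FTC2 _ (horner p^`()) (horner p)) => //.
- by apply: continuous_subspaceT => x; exact: continuous_horner.
- split.
  + by move=> x _; exact: derivable_horner.
  + by apply: cvg_at_right_filter; exact: continuous_horner.
  + by apply: cvg_at_left_filter; exact: continuous_horner.
- by move=> x _; rewrite derivE.
Qed.

Lemma measurable_inv : measurable_fun setT (fun x : R => x^-1).
Proof.
rewrite -(setUv [set 0]); apply/measurable_funU => //.
  exact: measurableC.
split; first exact: measurable_fun_set1.
apply: open_continuous_measurable_fun.
  by rewrite openC; exact/accessible_closed_set1/hausdorff_accessible/Rhausdorff.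
by move=> x; rewrite inE => /eqP x0; exact: inv_continuous.
Qed.

(* Since [0 / 0 = 0], [tent 0 0 = 1]; this makes the majorant below valid at the
   centre of the parallelogram as well. *)
Definition tent (q t : R) : R := if `|q| <= t then 1 - `|q| / t else 0.

Lemma tent_ge0 (q t : R) : 0 <= tent q t.
Proof.
rewrite /tent; case: ifPn => // qt; rewrite subr_ge0.
have [t0|t0] := ltP 0 t; first by rewrite ler_pdivrMr// mul1r.
by rewrite (le_trans _ ler01)// mulr_ge0_le0// invr_le0.
Qed.

Lemma measurable_tent : measurable_fun setT (fun z : R * R => tent z.1 z.2).
Proof.
have mX : measurable_fun setT (fun z : R * R => `|z.1|).
  by apply: measurableT_comp => //; exact: measurable_fst.
have mY : measurable_fun setT (snd : R * R -> R) by exact: measurable_snd.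
apply: measurable_fun_ifT; last exact: measurable_cst.
- exact: measurable_fun_ler.
- apply: measurable_funB; first exact: measurable_cst.
  apply: measurable_funM => //.
  by apply: (measurableT_comp measurable_inv).
Qed.

(** The graph is a triangle of base [2 t] and height [1]; the two slopes are integrated separately
    on either side of [0]. *)
Lemma integral_tent (t : R) : 0 < t -> (\int[mu]_q (tent q t)%:E = t%:E)%E.
Proof.
move=> t0.
have t0' : t != 0 by rewrite gt_eqF.
have mt : measurable_fun setT (fun q => (tent q t)%:E).
  apply/measurable_EFinP.
  exact: (measurableT_comp measurable_tent
    (measurable_fun_pair (@measurable_id _ _ setT) (measurable_cst _))).
transitivity (\int[mu]_(q in `[(- t)%R, t]) (tent q t)%:E)%E.
  rewrite [RHS]integral_mkcond; apply: eq_integral => q _.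
  rewrite /patch; case: ifPn => //; rewrite notin_setE/= in_itv/= -ler_norml.
  by move/negP/negbTE => h; rewrite /tent h.
rewrite (@itv_bndbnd_setU _ _ _ (BLeft 0)) ?bnd_simp; last 2 first.
- by rewrite oppr_le0 ltW.
- by rewrite ltW.
rewrite ge0_integral_setU//=; last 3 first.
- exact: measurable_funS mt.
- by move=> q _; rewrite lee_fin tent_ge0.
- by apply/disj_setPS => y [/=]; rewrite !in_itv/= => /andP[_ y0] /andP[]; rewrite leNgt y0.
rewrite integral_itv_bndo_bndc; last exact: measurable_funS mt.
(* [p s] is an antiderivative of [1 + s q / t]: the sign [s = 1] gives the left slope of the tent
   and [s = -1] the right one. *)
pose p (s : R) : {poly R} := 'X + (s / (2 * t)) *: 'X^2.
have pE s q : (p s)^`().[q] = 1 + s * q / t.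
  rewrite /p derivD derivX linearZ/= derivXn !hornerE/=. by field.
have pE' s q : (p s).[q] = q + s * q ^+ 2 / (2 * t).
  by rewrite /p !hornerE/= (mulrAC s) (mulrAC (s * q)).
transitivity (\int[mu]_(q in `[(- t)%R, 0%R]) ((p 1)^`().[q])%:E +
   \int[mu]_(q in `[0%R, t]) ((p (-1))^`().[q])%:E)%E.
  congr (_ + _)%E; apply: eq_integral => q; rewrite inE/= in_itv/= => /andP[h1 h2].
    rewrite pE /tent ler0_norm// ifT; last lra.
    by congr EFin; field.
  rewrite pE /tent ger0_norm// ifT; last lra.
  by congr EFin; field.
rewrite !integral_deriv_poly// ?oppr_lt0// -EFinD !pE'; congr EFin; by field.
Qed.

(* The tent function carried along the unfolding [p |-> e p + |q|], which for
   [e = 1] and [e = -1] sends the half of the diamond [|p| + |q| <= 1] with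
   [e p >= 0] to pairs [(q, t)] with [|q| <= t <= 1]. *)
Definition fold_tent (e : R) (g : R -> R) (z : R * R) : R :=
  tent z.2 (e * z.1 + `|z.2|) * g (e * z.1 + `|z.2|).

Lemma fold_tent_ge0 (e : R) (g : R -> R) (z : R * R) :
  (forall t, 0 <= g t) -> 0 <= fold_tent e g z.
Proof. by move=> g0; rewrite mulr_ge0// tent_ge0. Qed.

Lemma measurable_fold_tent (e : R) (g : R -> R) : measurable_fun setT g ->
  measurable_fun setT (fold_tent e g).
Proof.
move=> mg.
have mX : measurable_fun setT (fst : R * R -> R) by exact: measurable_fst.
have mY : measurable_fun setT (snd : R * R -> R) by exact: measurable_snd.
have mA : measurable_fun setT (fun z : R * R => e * z.1 + `|z.2|).
  apply: measurable_funD; last exact: measurableT_comp.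
  by apply: measurable_funM => //; exact: measurable_cst.
apply: measurable_funM; last exact: measurableT_comp mg _.
exact: (measurableT_comp measurable_tent (measurable_fun_pair mY mA)).
Qed.

(** For fixed [q] the map [p |-> e p + |q|] preserves Lebesgue measure because [|e| = 1].
    Integrating over [q] first then replaces the tent by its area [t], which is how the first moment
    of [g] arises. *)
Lemma integral_fold_tent (e : R) (g : R -> R) : `|e| = 1 ->
    measurable_fun setT g -> (forall t, 0 <= g t) -> (forall t, t < 0 -> g t = 0) ->
  (\int[mu2]_z (fold_tent e g z)%:E = \int[mu]_t (t * g t)%:E)%E.
Proof.
move=> e1 mg g0 gneg.
have mX : measurable_fun setT (fst : R * R -> R) by exact: measurable_fst.
have mY : measurable_fun setT (snd : R * R -> R) by exact: measurable_snd.
have mt : measurable_fun setT (fun z : R * R => (tent z.2 z.1 * g z.1)%:E).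
  apply/measurable_EFinP; apply: measurable_funM; last exact: measurableT_comp mg _.
  exact: (measurableT_comp measurable_tent (measurable_fun_pair mY mX)).
have mf : measurable_fun setT (fun z : R * R => (fold_tent e g z)%:E).
  by apply/measurable_EFinP; exact: measurable_fold_tent.
have t0 q t : (0 <= (tent q t * g t)%:E)%E by rewrite lee_fin mulr_ge0 ?tent_ge0.
rewrite fubini_tonelli2//=; last by move=> z; rewrite lee_fin fold_tent_ge0.
rewrite /fubini_G/= /fold_tent/=.
transitivity (\int[mu]_y \int[mu]_x (tent y x * g x)%:E)%E.
  apply: eq_integral => y _.
  rewrite (@ge0_integral_affine _ e `|y| (fun x => (tent y x * g x)%:E))//.
  - by rewrite e1 invr1 mul1e.
  - by rewrite -normr_eq0 e1 oner_neq0.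
  - exact: (measurable_fun_pair1 y mt).
rewrite -(@fubini_tonelli _ _ _ _ R mu mu _ mt)//=.
apply: eq_integral => t _.
under eq_integral do rewrite mulrC EFinM.
rewrite ge0_integralZl_EFin//; last 2 first.
- by move=> q _; rewrite lee_fin tent_ge0.
- apply/measurable_EFinP.
  exact: (measurableT_comp measurable_tent
    (measurable_fun_pair (@measurable_id _ _ setT) (measurable_cst _))).
have [tn|tp|->] := ltgtP t 0.
- by rewrite gneg// mul0e mulr0.
- by rewrite integral_tent// -EFinM mulrC.
rewrite mul0r; apply/eqP; rewrite mule_eq0; apply/orP; right; apply/eqP.
(* At [t = 0] the tent is nonzero only at [q = 0], a null set. *)
have -> : (\int[mu]_q (tent q 0)%:E = \int[mu]_(q in [set 0%R]) (tent q 0)%:E)%E.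
  rewrite [RHS]integral_mkcond; apply: eq_integral => q _.
  rewrite /patch; case: ifPn => //; rewrite notin_setE/= => /eqP q0.
  by rewrite /tent normr_le0 (negbTE q0).
by rewrite integral_set1.
Qed.

End tent.

(** * Convex functions on the unit interval and their first moment *)

Section interval.
Context {R : realType}.
Notation mu := (@lebesgue_measure R).

Lemma integrable_affine (a b : R) (h : R -> R) : a != 0 ->
  mu.-integrable setT (EFin \o h) ->
  mu.-integrable setT (EFin \o (fun x => h (a * x + b))).
Proof.
move=> a0 /integrableP[mh ih]; apply/integrableP; split.
  exact: (measurableT_comp mh (measurable_affine a b)).
rewrite (@ge0_integral_affine _ a b (fun x => `|(h x)%:E|%E))//; last first.
  exact: measurableT_comp.
by rewrite lte_mul_pinfty// lee_fin invr_ge0.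
Qed.

Lemma Rintegral_affine (a b : R) (h : R -> R) : a != 0 ->
  mu.-integrable setT (EFin \o h) ->
  \int[mu]_x h (a * x + b) = `|a|^-1 * \int[mu]_x h x.
Proof.
move=> a0 ih; have /integrableP[mh _] := ih.
rewrite /Rintegral [in RHS]integralE.
have -> : (\int[mu]_x (h (a * x + b)%R)%:E =
    `|a|^-1%:E * \int[mu]_x (EFin \o h)^\+ x -
    `|a|^-1%:E * \int[mu]_x (EFin \o h)^\- x)%E.
  rewrite integralE; congr (_ - _)%E.
    rewrite -(@ge0_integral_affine _ a b ((EFin \o h)^\+)%E)//;
      last exact: measurable_funepos.
    by apply: eq_integral => x _; rewrite ?funeposE ?funenegE.
  rewrite -(@ge0_integral_affine _ a b ((EFin \o h)^\-)%E)//;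
      last exact: measurable_funeneg.
    by apply: eq_integral => x _; rewrite ?funeposE ?funenegE.
have fp : (\int[mu]_x (EFin \o h)^\+ x \is a fin_num)%E by exact: integrable_pos_fin_num.
have fn : (\int[mu]_x (EFin \o h)^\- x \is a fin_num)%E by exact: integrable_neg_fin_num.
by rewrite -muleBr ?fin_num_adde_defl ?fin_numN// fineM// fin_numB fp fn.
Qed.

(** Both halves are parametrized outwards from the midpoint [1/2]; this cuts the average over a
    diagonal into those over its two half-diagonals. *)
Lemma Rintegral_halves (phi : R -> R) :
  mu.-integrable `[0, 1] (EFin \o (fun t => phi ((1 - t) / 2))) ->
  mu.-integrable `[0, 1] (EFin \o (fun t => phi ((1 + t) / 2))) ->
  \int[mu]_(t in `[0, 1]) phi t =
  (\int[mu]_(t in `[0, 1]) phi ((1 - t) / 2) +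
   \int[mu]_(t in `[0, 1]) phi ((1 + t) / 2)) / 2.
Proof.
move=> il ir.
(* The midpoint has parameter [0] in both halves. Opening one of the intervals at [0] keeps it from
   being counted twice, so the zero extensions add up to [phi] pointwise. *)
have ir' : mu.-integrable `]0, 1] (EFin \o (fun t => phi ((1 + t) / 2))).
  by apply: integrableS ir => //; apply: subset_itvr; rewrite bnd_simp.
rewrite -[X in _ + X]Rintegral_itv_obnd_cbnd//.
rewrite [in LHS]Rintegral_mkcond [X in X + _]Rintegral_mkcond [X in _ + X]Rintegral_mkcond.
pose l := (fun t => phi ((1 - t) / 2)) \_ `[0, 1].
pose r := (fun t => phi ((1 + t) / 2)) \_ `]0, 1].
rewrite -/l -/r.
have iL : mu.-integrable setT (EFin \o l).
  by rewrite /l -restrict_EFin; apply/(@integrable_mkcond _ _ _ mu _ _ (measurable_itv _)).1.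
have iR : mu.-integrable setT (EFin \o r).
  by rewrite /r -restrict_EFin; apply/(@integrable_mkcond _ _ _ mu _ _ (measurable_itv _)).1.
have n2 : (-2 : R) != 0 by rewrite oppr_eq0 pnatr_eq0.
have p2 : (2 : R) != 0 by rewrite pnatr_eq0.
transitivity (\int[mu]_t (l (-2 * t + 1) + r (2 * t + (-1)))).
  apply: eq_Rintegral => t _.
  rewrite /l /r !patchE !mem_setE !in_itv/=.
  have -> : (0 <= -2 * t + 1 <= 1) = (0 <= t <= 2^-1).
    by apply/idP/idP => /andP[? ?]; apply/andP; split; lra.
  have -> : (0 < 2 * t + -1 <= 1) = (2^-1 < t <= 1).
    by apply/idP/idP => /andP[? ?]; apply/andP; split; lra.
  have -> : (1 - (-2 * t + 1)) / 2 = t by field.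
  have -> : (1 + (2 * t + -1)) / 2 = t by field.
  have [th|th] := leP t 2^-1.
    by rewrite andbT /= addr0 (_ : t <= 1) ?andbT//; lra.
  by rewrite andbF /= add0r (_ : 0 <= t)//; lra.
rewrite RintegralD//; [|exact: integrable_affine..].
rewrite !Rintegral_affine// normrN normr_nat.
by rewrite mulrDl ![_ / 2]mulrC.
Qed.

Definition convex01 (g : R -> R) := forall x y t : R,
  0 <= x <= 1 -> 0 <= y <= 1 -> 0 <= t <= 1 ->
  g (t * x + (1 - t) * y) <= t * g x + (1 - t) * g y.

(** The strict sublevel sets of a convex function are intervals, and the rays []-oo, c[] generate
    the Borel sets. *)
Lemma convex01_measurable (g : R -> R) : convex01 g -> measurable_fun (`[0, 1] : set R) g.
Proof.
move=> cg; apply: (measurability _ (RGenInftyO.measurableE R)) => _ [_ [c ->] <-].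
apply: is_interval_measurable => x y [/= x01 gx] [/= y01 gy] z /andP[xz zy].
move: x01 y01; rewrite /= !in_itv/= in gx gy *.
move=> /andP[x0 x1] /andP[y0 y1]; split; first by apply/andP; split; lra.
have [xy|xy] := eqVneq x y.
  by have -> : z = x by apply/le_anti; rewrite xz xy zy.
have yx : 0 < y - x by rewrite subr_gt0 lt_neqAle xy (le_trans xz).
pose t := (y - z) / (y - x).
have t01 : 0 <= t <= 1.
  by rewrite /t ler_pdivlMr// mul0r ler_pdivrMr// mul1r; apply/andP; split; lra.
have -> : z = t * x + (1 - t) * y by rewrite /t; field; rewrite gt_eqF.
apply: (le_lt_trans (cg _ _ _ _ _ t01)); [exact/andP|exact/andP|].
have /andP[t0 t1] := t01.
set m := Num.max (g x) (g y); have mc : m < c by rewrite gt_max gx gy.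
have xm : g x <= m by rewrite le_max lexx.
have ym : g y <= m by rewrite le_max lexx orbT.
apply: le_lt_trans mc; nra.
Qed.

(** The endpoint values bound [g] from above. Since [1/2] is the midpoint of [t] and [1 - t], the
    value [g (1/2)] and the upper bound at [1 - t] give a lower bound at [t]. *)
Lemma convex01_bounded (g : R -> R) : convex01 g ->
  exists M, forall t, 0 <= t <= 1 -> `|g t| <= M.
Proof.
move=> cg.
have ub t : 0 <= t <= 1 -> g t <= `|g 0| + `|g 1|.
  move=> /[dup] t01 /andP[t0 t1].
  have := cg 1 0 t; rewrite mulr0 addr0 mulr1 !lexx !ler01 => /(_ isT isT t01).
  have := ler_norm (g 0); have := ler_norm (g 1).
  have := normr_ge0 (g 0); have := normr_ge0 (g 1).
  by nra.
exists (`|g 0| + `|g 1| + 2 * `|g 2^-1|) => t /[dup] t01 /andP[t0 t1].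
have t01' : 0 <= 1 - t <= 1 by apply/andP; split; lra.
have := cg t (1 - t) 2^-1 t01 t01'.
have -> : 2^-1 * t + (1 - 2^-1) * (1 - t) = 2^-1 by field.
have h : 0 <= (2^-1 : R) <= 1 by apply/andP; split; lra.
move=> /(_ h) m.
have := ub _ t01; have := ub _ t01' => u1 u2.
have := ler_norm (- g 2^-1); rewrite normrN => n.
have := normr_ge0 (g 2^-1) => n0.
by rewrite ler_norml; apply/andP; split; lra.
Qed.

Lemma bounded01_integrable (g : R -> R) (M : R) :
  measurable_fun (`[0, 1] : set R) g -> (forall t, 0 <= t <= 1 -> `|g t| <= M) ->
  mu.-integrable `[0, 1] (EFin \o g).
Proof.
move=> mg gM; apply: measurable_bounded_integrable => //.
  by rewrite /= lebesgue_measure_itv/= lte_fin ltr01 -EFinB ltry.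
exists M; split; first exact: num_real.
by move=> x Mx t /=; rewrite in_itv/= => /gM/le_trans -> //; exact: ltW.
Qed.

Lemma convex01_integrable (g : R -> R) : convex01 g ->
  mu.-integrable `[0, 1] (EFin \o g).
Proof.
move=> cg; have [M gM] := convex01_bounded _ cg.
by apply: (@bounded01_integrable _ M) => //; exact: convex01_measurable.
Qed.

Lemma convex01_mulid_integrable (g : R -> R) : convex01 g ->
  mu.-integrable `[0, 1] (EFin \o (fun t => t * g t)).
Proof.
move=> cg; have [M gM] := convex01_bounded _ cg.
apply: (@bounded01_integrable _ M).
  by apply: measurable_funM; [exact: measurable_id|exact: convex01_measurable].
move=> t /[dup] t01 /andP[t0 t1]; rewrite normrM (ger0_norm t0).
by rewrite (le_trans _ (gM _ t01))// ler_piMl.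
Qed.

Lemma convex01_moment (g : R -> R) : convex01 g ->
  \int[mu]_(t in `[0, 1]) (t * g t) <=
  g 1 / 6 + (\int[mu]_(t in `[0, 1]) g t) / 3.
Proof.
move=> cg.
have ig := convex01_integrable _ cg.
have itg := convex01_mulid_integrable _ cg.
have ig3 : mu.-integrable `[0, 1] (EFin \o (fun t => 3^-1 * g t)).
  exact: (integrableZl _ (3^-1) ig).
rewrite -lerBlDr mulrC -RintegralZl// -RintegralB//.
(* Let [l] be the line through [(c, m)] and [(1, g 1)], of slope [k]. The integral of [(t - c) l(t)]
   over [[0, 1]] is free of [m] exactly when [c = 1/3], and then equals [g 1 / 6]. The polynomial
   [p] is an antiderivative of this integrand. *)
pose c : R := 3^-1.
pose m := g c.
pose k := 3 / 2 * (g 1 - m).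
pose p : {poly R} := (m / 2) *: ('X - c%:P) ^+ 2 + (k / 3) *: ('X - c%:P) ^+ 3.
have pE' t : p.[t] = m / 2 * (t - c) ^+ 2 + k / 3 * (t - c) ^+ 3.
  by rewrite /p hornerD !hornerZ !horner_exp hornerXsubC.
have pE t : (p^`()).[t] = (t - c) * (m + (t - c) * k).
  rewrite /p derivD !linearZ/= !deriv_exp derivXsubC !mul1r/=.
  rewrite !(hornerD, hornerZ, hornerMn, horner_exp, hornerN, hornerX, hornerC).
  by field.
have pI := integral_deriv_poly p _ _ (@ltr01 R).
have -> : g 1 / 6 = \int[mu]_(t in `[0, 1]) (p^`()).[t].
  rewrite /Rintegral pI/= !pE' /k /c; by field.
apply: le_Rintegral => //.
- exact: (integrableB _ itg ig3).
- apply: continuous_compact_integrable; first exact: segment_compact.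
  by apply: continuous_subspaceT => x; exact: continuous_horner.
move=> t /=; rewrite in_itv/= => /andP[t0 t1].
rewrite pE -mulrBl -/c.
have c01 : 0 <= c <= 1 by apply/andP; split; rewrite /c; lra.
have one01 : 0 <= (1 : R) <= 1 by apply/andP; split; lra.
have t01 : 0 <= t <= 1 by apply/andP; split; lra.
have [tc|tc] := leP c t.
  (* Here [t] lies between [c] and [1], so [g] is below the chord, and the factor [t - c] is
     nonnegative; [s] is the weight of [c] in [t]. *)
  rewrite ler_wpM2l ?subr_ge0//.
  pose s := (1 - t) * 3 / 2.
  have s01 : 0 <= s <= 1.
    by rewrite /s; move: tc; rewrite /c => tc; apply/andP; split; lra.
  have := cg c 1 s c01 one01 s01.
  have -> : s * c + (1 - s) * 1 = t by rewrite /s /c; field.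
  move=> /le_trans; apply; rewrite le_eqVlt; apply/orP; left; apply/eqP.
  by rewrite -/m /s /k /c; field.
(* Here [c] lies between [t] and [1], so [g] is above the extended chord, and the factor [t - c] is
   negative; [s] is the weight of [t] in [c]. *)
rewrite ler_wnM2l ?subr_le0 ?(ltW tc)//.
have t1' : 0 < 1 - t by move: tc; rewrite /c; lra.
pose s := 2 / 3 / (1 - t).
have s0 : 0 < s by rewrite divr_gt0//; lra.
have s01 : 0 <= s <= 1.
  rewrite ltW//= /s ler_pdivrMr// mul1r; move: tc; rewrite /c; lra.
have := cg t 1 s t01 one01 s01.
have -> : s * t + (1 - s) * 1 = c by rewrite /s /c; field; rewrite gt_eqF.
rewrite -/m => h.
have E : s * (m + (t - c) * k) = m - (1 - s) * g 1.
  by rewrite /s /k /c; field; rewrite gt_eqF.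
have : s * (m + (t - c) * k) <= s * g t by rewrite E lerBlDr.
by rewrite ler_pM2l.
Qed.

End interval.

(** * Monotonicity of the integral without measurability of the smaller function *)

Section nonmeasurable.
Context d (T : measurableType d) (R : realType).
Variable mu : {measure set T -> \bar R}.

(** The integral of a nonnegative function is a supremum over the simple functions below it, and
    this family grows with the function. *)
Lemma ge0_le_integral_nonmeasurable (D : set T) (f g : T -> \bar R) :
    (forall x, D x -> 0 <= f x)%E -> (forall x, D x -> f x <= g x)%E ->
  (\int[mu]_(x in D) f x <= \int[mu]_(x in D) g x)%E.
Proof.
move=> f0 fg.
have g0 x : D x -> (0 <= g x)%E by move=> Dx; rewrite (le_trans (f0 _ Dx))// fg.
rewrite (integral_mkcond D f) (integral_mkcond D g).
rewrite !ge0_integralTE; [|exact: erestrict_ge0..].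
apply: le_ereal_sup => _ [h hf <-]; exists h => // x.
by rewrite (le_trans (hf x))// lee_restrict.
Qed.

(** Passing from [f] to [g] enlarges the positive part and shrinks the negative part. As [fine]
    sends infinite values to [0], all four integrals must be finite: that of the negative part of
    [f] is at most [|M|] times the measure of [D], the others are controlled by [g]. *)
Lemma le_Rintegral_nonmeasurable (D : set T) (f g : T -> R) (M : R) :
    measurable D -> (mu D < +oo)%E -> mu.-integrable D (EFin \o g) ->
    (forall x, D x -> - M <= f x) -> (forall x, D x -> f x <= g x) ->
  \int[mu]_(x in D) f x <= \int[mu]_(x in D) g x.
Proof.
move=> mD Doo ig fM fg.
have hp : (\int[mu]_(x in D) (EFin \o f)^\+ x <= \int[mu]_(x in D) (EFin \o g)^\+ x)%E.
  apply: ge0_le_integral_nonmeasurable => x Dx; first exact: funepos_ge0.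
  by rewrite !funeposE/= -!EFin_max lee_fin ge_max !le_max fg// lexx orbT.
have hn : (\int[mu]_(x in D) (EFin \o g)^\- x <= \int[mu]_(x in D) (EFin \o f)^\- x)%E.
  apply: ge0_le_integral_nonmeasurable => x Dx; first exact: funeneg_ge0.
  by rewrite !funenegE/= -!EFin_max lee_fin ge_max !le_max lerN2 fg// lexx orbT.
have gp := integrable_pos_fin_num mD ig.
have gn := integrable_neg_fin_num mD ig.
have fp : (\int[mu]_(x in D) (EFin \o f)^\+ x \is a fin_num)%E.
  rewrite ge0_fin_numE; last by apply: integral_ge0 => x _; exact: funepos_ge0.
  by rewrite (le_lt_trans hp)// ltey_eq gp.
have fn : (\int[mu]_(x in D) (EFin \o f)^\- x \is a fin_num)%E.
  rewrite ge0_fin_numE; last by apply: integral_ge0 => x _; exact: funeneg_ge0.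
  apply: (@le_lt_trans _ _ (\int[mu]_(x in D) (`|M|%:E)))%E.
    apply: ge0_le_integral_nonmeasurable => x Dx; first exact: funeneg_ge0.
    rewrite funenegE/= -EFin_max lee_fin ge_max normr_ge0 andbT.
    by rewrite (le_trans _ (ler_norm M))// lerNl fM.
  by rewrite integral_cst// lte_mul_pinfty.
rewrite /Rintegral integralE [in leRHS]integralE.
by apply: fine_le; [rewrite fin_numB fp fn|rewrite fin_numB gp gn|exact: leeB].
Qed.

End nonmeasurable.

(** * Convex functions on a triangle, in coordinates along two half-diagonals *)

Section triangle.
Context {R : realType}.

Definition triangle_convex (F : R -> R -> R) := forall p q p' q' t : R,
  0 <= p -> 0 <= q -> p + q <= 1 -> 0 <= p' -> 0 <= q' -> p' + q' <= 1 ->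
  0 <= t <= 1 ->
  F (t * p + (1 - t) * p') (t * q + (1 - t) * q') <=
  t * F p q + (1 - t) * F p' q'.

Lemma scale_pairE (k : R) (z : R * R) : k *: z = (k * z.1, k * z.2).
Proof. by []. Qed.

Lemma convex_on_triangle (O U V : R * R) (f : R * R -> R) :
  convex_on (conv3 (O + U) O (O + V)) f ->
  triangle_convex (fun p q => f (O + p *: U + q *: V)).
Proof.
move=> cf p q p' q' t p0 q0 pq p'0 q'0 pq' t01.
have mem (a b : R) : 0 <= a -> 0 <= b -> a + b <= 1 ->
    conv3 (O + U) O (O + V) (O + a *: U + b *: V).
  move=> a0 b0 ab; exists a, (1 - a - b), b; split=> //; [lra|ring|].
  by rewrite !scale_pairE; case: O U V {cf} => [? ?] [? ?] [? ?];
    congr pair => /=; ring.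
have := cf _ _ t (mem _ _ p0 q0 pq) (mem _ _ p'0 q'0 pq') t01.
congr (f _ <= _).
by rewrite !scale_pairE; case: O U V {cf mem} => [? ?] [? ?] [? ?];
    congr pair => /=; ring.
Qed.

Section theory.
Variable F : R -> R -> R.
Hypothesis cF : triangle_convex F.

Lemma triangle_convex_edge1 : convex01 (F ^~ 0).
Proof.
move=> x y t /andP[x0 x1] /andP[y0 y1] t01.
have := @cF x 0 y 0 t x0 (lexx _) _ y0 (lexx _) _ t01.
by rewrite !addr0 !mulr0 addr0; apply.
Qed.

Lemma triangle_convex_edge2 : convex01 (F 0).
Proof.
move=> x y t /andP[x0 x1] /andP[y0 y1] t01.
have := @cF 0 x 0 y t (lexx _) x0 _ (lexx _) y0 _ t01.
by rewrite !add0r !mulr0 addr0; apply.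
Qed.

Lemma triangle_convex_chord (p q : R) : 0 <= p -> 0 <= q -> 0 < p + q <= 1 ->
  F p q <= p / (p + q) * F (p + q) 0 + q / (p + q) * F 0 (p + q).
Proof.
move=> p0 q0 /andP[s0 s1].
have t01 : 0 <= p / (p + q) <= 1.
  by rewrite divr_ge0 ?(ltW s0)//= ler_pdivrMr// mul1r lerDl.
have := @cF (p + q) 0 0 (p + q) (p / (p + q)) (ltW s0) (lexx _) _ (lexx _) (ltW s0) _ t01.
rewrite addr0 add0r !mulr0 addr0 add0r => /(_ s1 s1).
have -> : 1 - p / (p + q) = q / (p + q) by field; rewrite gt_eqF.
by rewrite !divfK ?gt_eqF.
Qed.

(** Chords between the two bounded edges give an upper bound on the whole triangle; reflecting it
    through the centroid yields the lower bound. *)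
Lemma triangle_convex_lower_bound :
  exists M, forall p q : R, 0 <= p -> 0 <= q -> p + q <= 1 -> - M <= F p q.
Proof.
have [M1 hM1] := convex01_bounded _ triangle_convex_edge1.
have [M2 hM2] := convex01_bounded _ triangle_convex_edge2.
have z01 : 0 <= (0 : R) <= 1 by rewrite lexx ler01.
have M10 : 0 <= M1 by exact: le_trans (normr_ge0 _) (hM1 _ z01).
have M20 : 0 <= M2 by exact: le_trans (normr_ge0 _) (hM2 _ z01).
have ub p q : 0 <= p -> 0 <= q -> p + q <= 1 -> F p q <= M1 + M2.
  move=> p0 q0 pq; have [s0|s0] := ltP 0 (p + q); last first.
    have -> : p = 0 by lra.
    have -> : q = 0 by lra.
    by rewrite (le_trans (ler_norm _))// (le_trans (hM1 _ z01))// lerDl.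
  have s01 : 0 < p + q <= 1 by rewrite s0.
  apply: le_trans (triangle_convex_chord _ _ p0 q0 s01) _.
  have s01' : 0 <= p + q <= 1 by rewrite ltW.
  apply: lerD.
    rewrite (le_trans (ler_norm _))// normrM ger0_norm ?divr_ge0 ?(ltW s0)//.
    rewrite (le_trans _ (hM1 _ s01'))// ler_piMl// ler_pdivrMr// mul1r; lra.
  rewrite (le_trans (ler_norm _))// normrM ger0_norm ?divr_ge0 ?(ltW s0)//.
  rewrite (le_trans _ (hM2 _ s01'))// ler_piMl// ler_pdivrMr// mul1r; lra.
(* The centroid [(1/3, 1/3)] is [1/3] of [(p, q)] plus [2/3] of [((1 - p) / 2, (1 - q) / 2)], a
   point that is again in the triangle. *)
exists (2 * (M1 + M2) - 3 * F 3^-1 3^-1) => p q p0 q0 pq.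
have t01 : 0 <= (3^-1 : R) <= 1 by apply/andP; split; lra.
have a0 : 0 <= (1 - p) / 2 by lra.
have b0 : 0 <= (1 - q) / 2 by lra.
have ab : (1 - p) / 2 + (1 - q) / 2 <= 1 by lra.
have := @cF p q ((1 - p) / 2) ((1 - q) / 2) 3^-1 p0 q0 pq a0 b0 ab t01.
have -> : 3^-1 * p + (1 - 3^-1) * ((1 - p) / 2) = 3^-1 by field.
have -> : 3^-1 * q + (1 - 3^-1) * ((1 - q) / 2) = 3^-1 by field.
have := ub _ _ a0 b0 ab; lra.
Qed.

(** With [s = p + q], the chord weights [p / s] and [q / s] are [tent q s] and [tent p s]. They sum
    to [1] away from the origin, so the shift by [c] passes through the interpolation. *)
Lemma triangle_convex_tent (c p q : R) :
    (forall t, 0 <= t <= 1 -> 0 <= F t 0 + c) ->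
    (forall t, 0 <= t <= 1 -> 0 <= F 0 t + c) ->
    0 <= p -> 0 <= q -> p + q <= 1 ->
  F p q + c <= tent q (p + q) * (F (p + q) 0 + c) +
               tent p (p + q) * (F 0 (p + q) + c).
Proof.
move=> F1 F2 p0 q0 pq; have [s0|s0] := ltP 0 (p + q); last first.
  (* At the origin both tents equal [1], so the right side is twice the left one and nonnegativity
     settles the case. *)
  have -> : p = 0 by lra.
  have -> : q = 0 by lra.
  rewrite addr0 /tent normr0 lexx mul0r subr0 !mul1r lerDl.
  by apply: F2; rewrite lexx ler01.
rewrite /tent !ger0_norm// lerDl lerDr p0 q0.
have -> : 1 - q / (p + q) = p / (p + q) by field; rewrite gt_eqF.
have -> : 1 - p / (p + q) = q / (p + q) by field; rewrite gt_eqF.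
have s01 : 0 < p + q <= 1 by rewrite s0.
have := triangle_convex_chord _ _ p0 q0 s01.
have : p / (p + q) * c + q / (p + q) * c = c by field; rewrite gt_eqF.
rewrite !mulrDr; lra.
Qed.

End theory.
End triangle.

(** * The diamond and the majorant built from its four half-diagonals *)

Section diamond.
Context {R : realType}.
Notation mu := (@lebesgue_measure R).
Notation mu2 := (@leb2 R).
Implicit Types (e : R) (g : R -> R) (z : R * R).

Definition diamond : set (R * R) := [set z | `|z.1| + `|z.2| <= 1].

Lemma measurable_diamond : measurable diamond.
Proof.
have mX : measurable_fun setT (fun z : R * R => `|z.1|).
  by apply: measurableT_comp => //; exact: measurable_fst.
have mY : measurable_fun setT (fun z : R * R => `|z.2|).
  by apply: measurableT_comp => //; exact: measurable_snd.
have mS : measurable_fun setT (fun z : R * R => `|z.1| + `|z.2|) by exact: measurable_funD.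
have := mS measurableT `]-oo, 1]%classic (measurable_itv _).
by rewrite setTI; congr measurable; apply/seteqP; split => z /=; rewrite in_itv/=.
Qed.

(** The section at [x] is an interval of length [2 * tent x 1]. *)
Lemma leb2_diamond : mu2 diamond = 2%:E.
Proof.
transitivity (\int[mu]_x (2%:E * (tent x 1)%:E))%E.
  apply: eq_integral => x _ /=.
  have -> : xsection diamond x = `[- (1 - `|x|), 1 - `|x|]%classic.
    apply/seteqP; split => y; rewrite /xsection /diamond/= inE/= in_itv/=.
      by rewrite -ler_norml lerBrDl.
    by rewrite -ler_norml lerBrDl.
  rewrite lebesgue_measure_itv/= lte_fin /tent divr1.
  have [x1|x1] := ltP `|x| 1.
    by rewrite ifT ?(ltW x1)//; [rewrite -EFinB -EFinM; congr EFin; ring|lra].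
  rewrite ifF; last by apply/negbTE; rewrite -leNgt; lra.
  case: ifPn => x1'; last by rewrite mule0.
  by rewrite (_ : `|x| = 1) ?subrr ?mule0//; lra.
rewrite ge0_integralZl_EFin//; last 2 first.
- by move=> x _; rewrite lee_fin tent_ge0.
- apply/measurable_EFinP.
  exact: (measurableT_comp measurable_tent
    (measurable_fun_pair (@measurable_id _ _ setT) (measurable_cst _))).
by rewrite integral_tent// mule1.
Qed.

(** Each summand spreads the values along one half-diagonal over the two adjacent triangles. The
    indices follow the vertices [(1, 0)], [(0, 1)], [(-1, 0)], [(0, -1)]; exchanging coordinates
    reduces the vertical rays to the horizontal ones. *)
Definition diamond_majorant (g1 g2 g3 g4 : R -> R) (z : R * R) : R :=
  fold_tent 1 g1 z + fold_tent (-1) g3 z +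
  (fold_tent 1 g2 (z.2, z.1) + fold_tent (-1) g4 (z.2, z.1)).

Lemma measurable_fold_tent_swap e g : measurable_fun setT g ->
  measurable_fun setT (fun z : R * R => fold_tent e g (z.2, z.1)).
Proof.
move=> mg.
have mX : measurable_fun setT (fst : R * R -> R) by exact: measurable_fst.
have mY : measurable_fun setT (snd : R * R -> R) by exact: measurable_snd.
exact: (measurableT_comp (measurable_fold_tent e g mg) (measurable_fun_pair mY mX)).
Qed.

Lemma integral_fold_tent_swap e g : `|e| = 1 ->
    measurable_fun setT g -> (forall t, 0 <= g t) -> (forall t, t < 0 -> g t = 0) ->
  (\int[mu2]_z (fold_tent e g (z.2, z.1))%:E = \int[mu]_t (t * g t)%:E)%E.
Proof.
move=> e1 mg g0 gneg; rewrite -(integral_fold_tent e)//.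
have m1 : measurable_fun setT (fun z => (fold_tent e g z)%:E).
  by apply/measurable_EFinP; exact: measurable_fold_tent.
have m2 : measurable_fun setT (fun z : R * R => (fold_tent e g (z.2, z.1))%:E).
  by apply/measurable_EFinP; exact: measurable_fold_tent_swap.
have p1 z : (0 <= (fold_tent e g z)%:E)%E by rewrite lee_fin fold_tent_ge0.
transitivity (\int[mu2]_z (fold_tent e g z)%:E)%E => //.
rewrite [LHS](@fubini_tonelli1 _ _ _ _ R mu mu _ m2)//.
by rewrite [RHS](@fubini_tonelli2 _ _ _ _ R mu mu _ m1).
Qed.

Lemma measurable_diamond_majorant g1 g2 g3 g4 :
    measurable_fun setT g1 -> measurable_fun setT g2 ->
    measurable_fun setT g3 -> measurable_fun setT g4 ->
  measurable_fun setT (diamond_majorant g1 g2 g3 g4).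
Proof.
move=> m1 m2 m3 m4; apply: measurable_funD; apply: measurable_funD;
  (exact: measurable_fold_tent || exact: measurable_fold_tent_swap).
Qed.

(** What [integral_fold_tent] asks of the values along one half-diagonal, extended by zero. *)
Definition ray_profile (g : R -> R) := [/\ measurable_fun setT g,
  forall t, 0 <= g t & forall t, t < 0 -> g t = 0].

Lemma diamond_majorant_ge0 g1 g2 g3 g4 z :
  ray_profile g1 -> ray_profile g2 -> ray_profile g3 -> ray_profile g4 ->
  0 <= diamond_majorant g1 g2 g3 g4 z.
Proof. by move=> [_ h1 _] [_ h2 _] [_ h3 _] [_ h4 _]; rewrite !addr_ge0 ?fold_tent_ge0. Qed.

Lemma integral_diamond_majorant g1 g2 g3 g4 :
    ray_profile g1 -> ray_profile g2 -> ray_profile g3 -> ray_profile g4 ->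
  (\int[mu2]_z (diamond_majorant g1 g2 g3 g4 z)%:E =
   \int[mu]_t (t * g1 t)%:E + \int[mu]_t (t * g3 t)%:E +
   (\int[mu]_t (t * g2 t)%:E + \int[mu]_t (t * g4 t)%:E))%E.
Proof.
move=> [m1 p1 n1] [m2 p2 n2] [m3 p3 n3] [m4 p4 n4].
have e1 : `|1 : R| = 1 by rewrite normr1.
have eN1 : `|-1 : R| = 1 by rewrite normrN1.
rewrite /diamond_majorant.
under eq_integral do rewrite !EFinD.
have mf e g : measurable_fun setT g -> measurable_fun setT (fun z => (fold_tent e g z)%:E).
  by move=> mg; apply/measurable_EFinP; exact: measurable_fold_tent.
have ms e g : measurable_fun setT g ->
    measurable_fun setT (fun z : R * R => (fold_tent e g (z.2, z.1))%:E).
  by move=> mg; apply/measurable_EFinP; exact: measurable_fold_tent_swap.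
have pf e g z : (forall t, 0 <= g t) -> (0 <= (fold_tent e g z)%:E)%E.
  by move=> g0; rewrite lee_fin fold_tent_ge0.
rewrite ge0_integralD//; last 4 first.
- by move=> z _; rewrite adde_ge0// pf.
- by apply: emeasurable_funD; exact: mf.
- by move=> z _; rewrite adde_ge0// pf.
- by apply: emeasurable_funD; exact: ms.
rewrite ge0_integralD//;
  [|by move=> z _; exact: pf|exact: mf|by move=> z _; exact: pf|exact: mf].
rewrite [X in (_ + X)%E]ge0_integralD//;
  [|by move=> z _; exact: pf|exact: ms|by move=> z _; exact: pf|exact: ms].
by rewrite !integral_fold_tent_swap// !integral_fold_tent.
Qed.

Lemma ray_profile_restrict (g : R -> R) : convex01 g ->
  (forall t, 0 <= t <= 1 -> 0 <= g t) -> ray_profile (g \_ `[0, 1]).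
Proof.
move=> cg g0; split.
- by apply/(measurable_restrictT _ _).1 => //; exact: convex01_measurable.
- by move=> t; rewrite patchE; case: ifPn => //; rewrite inE/= in_itv/= => /g0.
- by move=> t t0; rewrite patchE mem_setE in_itv/= leNgt t0.
Qed.

Lemma integral_ray_profile (g : R -> R) : convex01 g ->
  (\int[mu]_t (t * (g \_ `[0%R, 1%R]) t)%:E = (\int[mu]_(t in `[0, 1]) (t * g t))%:E)%E.
Proof.
move=> cg; rewrite /Rintegral fineK; last first.
  by apply: integrable_fin_num => //; exact: convex01_mulid_integrable.
rewrite [RHS]integral_mkcond; apply: eq_integral => t _.
by rewrite !patchE; case: ifPn; rewrite ?mulr0.
Qed.

Lemma convex01_addr (g : R -> R) (c : R) : convex01 g -> convex01 (fun t => g t + c).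
Proof. by move=> cg x y t x01 y01 t01; have := cg _ _ _ x01 y01 t01; lra. Qed.

Lemma Rintegral01_addr (g : R -> R) (c : R) : convex01 g ->
  \int[mu]_(t in `[0, 1]) (g t + c) = \int[mu]_(t in `[0, 1]) g t + c.
Proof.
move=> cg.
have mu1 : mu (`[0, 1]%classic : set R) = 1%E.
  by rewrite /= lebesgue_measure_itv/= lte_fin ltr01 oppr0 adde0.
rewrite RintegralD//; last 2 first.
- exact: convex01_integrable.
- by apply: (@bounded01_integrable _ _ `|c|) => //; exact: measurable_cst.
by rewrite Rintegral_cst// [X in fine X]mu1 mulr1.
Qed.

Section diamond_function.
Variable h : R -> R -> R.
(** Quarter turns carry each of the four triangles to the one in the first quadrant. *)
Hypothesis h1 : triangle_convex h.
Hypothesis h2 : triangle_convex (fun p q => h (- q) p).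
Hypothesis h3 : triangle_convex (fun p q => h (- p) (- q)).
Hypothesis h4 : triangle_convex (fun p q => h q (- p)).

Lemma diamond_lower_bound :
  exists M, forall p q : R, `|p| + `|q| <= 1 -> - M <= h p q.
Proof.
have [M1 H1] := triangle_convex_lower_bound _ h1.
have [M2 H2] := triangle_convex_lower_bound _ h2.
have [M3 H3] := triangle_convex_lower_bound _ h3.
have [M4 H4] := triangle_convex_lower_bound _ h4.
(* The signs of the four bounds are unknown; the absolute values make the sum dominate each of
   them. *)
exists (`|M1| + `|M2| + `|M3| + `|M4|) => p q.
have [n1 n2 n3 n4] := And4 (ler_norm M1) (ler_norm M2) (ler_norm M3) (ler_norm M4).
have [k1 k2 k3 k4] := And4 (normr_ge0 M1) (normr_ge0 M2) (normr_ge0 M3) (normr_ge0 M4).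
have [p0|p0] := ger0P p; have [q0|q0] := ger0P q => pq.
- by have := H1 p q p0 q0 pq; lra.
- have := H4 (- q) p; rewrite opprK => /(_ _ p0) H.
  by have := H ltac:(lra) ltac:(lra); lra.
- have := H2 q (- p); rewrite opprK => /(_ q0) H.
  by have := H ltac:(lra) ltac:(lra); lra.
- have := H3 (- p) (- q); rewrite !opprK => H.
  by have := H ltac:(lra) ltac:(lra) ltac:(lra); lra.
Qed.

(** In each quadrant two of the four summands form the bound of [triangle_convex_tent], up to a
    quarter turn, and the other two are nonnegative. *)
Lemma le_diamond_majorant (c p q : R) :
    (forall p q, `|p| + `|q| <= 1 -> 0 <= h p q + c) ->
    `|p| + `|q| <= 1 ->
  h p q + c <= diamond_majorant
    ((fun t => h t 0 + c) \_ `[0, 1]) ((fun t => h 0 t + c) \_ `[0, 1])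
    ((fun t => h (- t) 0 + c) \_ `[0, 1]) ((fun t => h 0 (- t) + c) \_ `[0, 1])
    (p, q).
Proof.
move=> hc pq.
have pos (k : R -> R) : (forall t, 0 <= t <= 1 -> 0 <= k t) ->
    forall t, 0 <= (k \_ `[0, 1]) t.
  by move=> k0 t; rewrite patchE; case: ifPn => //; rewrite inE/= in_itv/= => /k0.
have k1 t : 0 <= t <= 1 -> 0 <= h t 0 + c.
  by move=> /andP[t0 t1]; rewrite hc// normr0 addr0 ger0_norm.
have k2 t : 0 <= t <= 1 -> 0 <= h 0 t + c.
  by move=> /andP[t0 t1]; rewrite hc// normr0 add0r ger0_norm.
have k3 t : 0 <= t <= 1 -> 0 <= h (- t) 0 + c.
  by move=> /andP[t0 t1]; rewrite hc// normr0 addr0 normrN ger0_norm.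
have k4 t : 0 <= t <= 1 -> 0 <= h 0 (- t) + c.
  by move=> /andP[t0 t1]; rewrite hc// normr0 add0r normrN ger0_norm.
have z (k : R -> R) e (z : R * R) : (forall t, 0 <= t <= 1 -> 0 <= k t) ->
    0 <= fold_tent e (k \_ `[0, 1]) z.
  by move=> k0; apply: fold_tent_ge0; exact: pos.
have E (k : R -> R) e (x y s : R) : e * x + `|y| = s -> 0 <= s <= 1 ->
    fold_tent e (k \_ `[0, 1]) (x, y) = tent y s * k s.
  by move=> es s01; rewrite /fold_tent/= es patchE mem_setE in_itv/= s01.
have tentN x y : tent (- x) y = tent x y by rewrite /tent normrN.
have Z1 a b : 0 <= fold_tent 1 ((fun t => h t 0 + c) \_ `[0, 1]) (a, b) by exact: z.
have Z2 a b : 0 <= fold_tent 1 ((fun t => h 0 t + c) \_ `[0, 1]) (a, b) by exact: z.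
have Z3 a b : 0 <= fold_tent (-1) ((fun t => h (- t) 0 + c) \_ `[0, 1]) (a, b) by exact: z.
have Z4 a b : 0 <= fold_tent (-1) ((fun t => h 0 (- t) + c) \_ `[0, 1]) (a, b) by exact: z.
have := Z1 p q; have := Z2 q p; have := Z3 p q; have := Z4 q p.
rewrite /diamond_majorant/=.
move: pq; have [p0|p0] := ger0P p; have [q0|q0] := ger0P q => pq.
- have s01 : 0 <= p + q <= 1 by apply/andP; split; lra.
  rewrite (E _ 1 p q (p + q) _ s01) ?(E _ 1 q p (p + q) _ s01);
    try (by rewrite ger0_norm//; lra).
  have := triangle_convex_tent h h1 c p q k1 k2 p0 q0 pq; lra.
- have s01 : 0 <= p - q <= 1 by apply/andP; split; lra.
  rewrite (E _ 1 p q (p - q) _ s01) ?(E _ (-1) q p (p - q) _ s01);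
    try (by rewrite ?(ger0_norm p0) ?(ltr0_norm q0)//; lra).
  have q0' : 0 <= - q by lra.
  have k1' t : 0 <= t <= 1 -> 0 <= h t (- 0) + c by rewrite oppr0; exact: k1.
  have := triangle_convex_tent (fun p q => h q (- p)) h4 c (- q) p k4 k1' q0' p0.
  by rewrite oppr0 opprK tentN (addrC (- q)) => /(_ pq); lra.
- have s01 : 0 <= q - p <= 1 by apply/andP; split; lra.
  rewrite (E _ (-1) p q (q - p) _ s01) ?(E _ 1 q p (q - p) _ s01);
    try (by rewrite ?(ger0_norm q0) ?(ltr0_norm p0)//; lra).
  have p0' : 0 <= - p by lra.
  have /andP[_ s1] := s01.
  have k2' t : 0 <= t <= 1 -> 0 <= h (- 0) t + c by rewrite oppr0; exact: k2.
  have := triangle_convex_tent (fun p q => h (- q) p) h2 c q (- p) k2' k3 q0 p0' s1.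
  by rewrite oppr0 opprK tentN; lra.
- have s01 : 0 <= - p - q <= 1 by apply/andP; split; lra.
  rewrite (E _ (-1) p q (- p - q) _ s01) ?(E _ (-1) q p (- p - q) _ s01);
    try (by rewrite ?(ltr0_norm q0) ?(ltr0_norm p0)//; lra).
  have p0' : 0 <= - p by lra.
  have q0' : 0 <= - q by lra.
  have k3' t : 0 <= t <= 1 -> 0 <= h (- t) (- 0) + c by rewrite oppr0; exact: k3.
  have k4' t : 0 <= t <= 1 -> 0 <= h (- 0) (- t) + c by rewrite oppr0; exact: k4.
  have := triangle_convex_tent (fun p q => h (- p) (- q)) h3 c (- p) (- q) k3' k4' p0' q0' pq.
  by rewrite oppr0 !opprK !tentN; lra.
Qed.

End diamond_function.
End diamond.

(** * Transfer from the diamond to the parallelogram by affine coordinates *)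

Section parallelogram.
Context {R : realType}.
Notation mu := (@lebesgue_measure R).
Notation mu2 := (@leb2 R).

(* Cramer's rule for [z = O + p *: U + q *: V]. *)
Definition affine_coords (O U V z : R * R) : R * R :=
  let D := U.1 * V.2 - U.2 * V.1 in
  (V.2 / D * z.1 + - V.1 / D * z.2 + (V.1 * O.2 - V.2 * O.1) / D,
   - U.2 / D * z.1 + U.1 / D * z.2 + (U.2 * O.1 - U.1 * O.2) / D).

Lemma affine_coordsK (O U V z : R * R) : U.1 * V.2 - U.2 * V.1 != 0 ->
  O + (affine_coords O U V z).1 *: U + (affine_coords O U V z).2 *: V = z.
Proof.
move=> D0; rewrite !scale_pairE /affine_coords.
by case: O U V z D0 => [? ?] [? ?] [? ?] [? ?] /= D0; congr pair => /=; field.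
Qed.

Lemma affine_coordsE (O U V : R * R) (p q : R) : U.1 * V.2 - U.2 * V.1 != 0 ->
  affine_coords O U V (O + p *: U + q *: V) = (p, q).
Proof.
move=> D0; rewrite !scale_pairE /affine_coords.
by case: O U V D0 => [? ?] [? ?] [? ?] /= D0; congr pair => /=; field.
Qed.

Lemma measurable_affine_coords (O U V : R * R) :
  measurable_fun setT (affine_coords O U V).
Proof.
have mX : measurable_fun setT (fst : R * R -> R) by exact: measurable_fst.
have mY : measurable_fun setT (snd : R * R -> R) by exact: measurable_snd.
by apply: measurable_fun_pair; apply: measurable_funD => //;
  apply: measurable_funD; apply: measurable_funM.
Qed.

(** The linear part of the coordinate map inverts the matrix with columns [U] and [V], so its
    determinant is the reciprocal of theirs. *)
Lemma ge0_integral_affine_coords (O U V : R * R) (G : R * R -> \bar R) :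
    U.1 * V.2 - U.2 * V.1 != 0 ->
    measurable_fun setT G -> (forall z, 0 <= G z)%E ->
  (\int[mu2]_z G (affine_coords O U V z) =
   `|U.1 * V.2 - U.2 * V.1|%R%:E * \int[mu2]_z G z)%E.
Proof.
move=> D0 mG G0; rewrite /affine_coords ge0_integral_affine2//; last first.
  rewrite (_ : _ - _ = (U.1 * V.2 - U.2 * V.1)^-1) ?invr_eq0//; by field.
congr (_%:E * _)%E; rewrite -normrV ?unitfE; last first.
  rewrite (_ : _ - _ = (U.1 * V.2 - U.2 * V.1)^-1) ?invr_eq0//; by field.
by congr (`|_|); field.
Qed.

(** Barycentric weights [a, b, c, d] give the coordinates [(a - c, b - d)], whose absolute values
    sum to at most [a + b + c + d = 1]. *)
Lemma conv4_diamond (O U V : R * R) : U.1 * V.2 - U.2 * V.1 != 0 ->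
  conv4 (O + U) (O + V) (O - U) (O - V) = affine_coords O U V @^-1` diamond.
Proof.
move=> D0; apply/seteqP; split => z.
  rewrite /preimage/= => -[a [b [c [d [[a0 b0 c0 d0 s] ->]]]]].
  have -> : a *: (O + U) + b *: (O + V) + c *: (O - U) + d *: (O - V) =
      O + (a - c) *: U + (b - d) *: V.
    have -> : a = 1 - b - c - d by lra.
    by rewrite !scale_pairE; case: O U V {D0} => [? ?] [? ?] [? ?];
    congr pair => /=; ring.
  rewrite affine_coordsE// /diamond/=.
  have : `|a - c| <= a + c by rewrite ler_norml; apply/andP; split; lra.
  have : `|b - d| <= b + d by rewrite ler_norml; apply/andP; split; lra.
  lra.
move=> zP; move: (zP : diamond (affine_coords O U V z)) (affine_coordsK O U V z D0) => {zP}.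
move: (affine_coords O U V z) => [p q]; rewrite /diamond/= => pq <-.
have hp := ler_norm p; have hp' := ler_norm (- p); rewrite normrN in hp'.
have hq := ler_norm q; have hq' := ler_norm (- q); rewrite normrN in hq'.
(* The weights are the positive and negative parts of [p] and [q]; the slack [1 - |p| - |q|] is
   shared equally among the vertices, where it cancels. *)
exists ((`|p| + p) / 2 + (1 - `|p| - `|q|) / 4), ((`|q| + q) / 2 + (1 - `|p| - `|q|) / 4),
  ((`|p| - p) / 2 + (1 - `|p| - `|q|) / 4), ((`|q| - q) / 2 + (1 - `|p| - `|q|) / 4).
split; first by split; lra.
rewrite !scale_pairE; case: O U V {D0} => [? ?] [? ?] [? ?].
by congr pair => /=; field.
Qed.

Section average.
Variables (O U V : R * R) (f : R * R -> R).
Let D := U.1 * V.2 - U.2 * V.1.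
Hypothesis D0 : D != 0.
Let h p q := f (O + p *: U + q *: V).
Hypothesis h1 : triangle_convex h.
Hypothesis h2 : triangle_convex (fun p q => h (- q) p).
Hypothesis h3 : triangle_convex (fun p q => h (- p) (- q)).
Hypothesis h4 : triangle_convex (fun p q => h q (- p)).
Let P := affine_coords O U V @^-1` diamond.

Lemma measurable_affine_diamond : measurable P.
Proof.
by rewrite -[P]setTI; apply: measurable_affine_coords => //; exact: measurable_diamond.
Qed.

Lemma leb2_affine_diamond : mu2 P = (2 * `|D|)%:E.
Proof.
transitivity (\int[mu2]_z (\1_P z)%:E)%E.
  by rewrite integral_indic ?setIT//; exact: measurable_affine_diamond.
rewrite (@ge0_integral_affine_coords _ _ _ (fun z => (\1_diamond z)%:E))//.
- rewrite integral_indic//; last exact: measurable_diamond.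
  by rewrite setIT [X in (_ * X)%E]leb2_diamond -EFinM mulrC.
- by apply/measurable_EFinP/measurable_indic; exact: measurable_diamond.
Qed.

Let ray1 : convex01 (h^~ 0) := triangle_convex_edge1 _ h1.
Let ray2 : convex01 (h 0) := triangle_convex_edge2 _ h1.
Let ray3 : convex01 (fun t => h (- t) 0).
Proof. by have := triangle_convex_edge1 _ h3; rewrite oppr0. Qed.
Let ray4 : convex01 (fun t => h 0 (- t)).
Proof. by have := triangle_convex_edge2 _ h3; rewrite oppr0. Qed.

Lemma Avg2_affine_diamond :
  Avg2 f P <= (h 1 0 + h 0 1 + h (- 1) 0 + h 0 (- 1)) / 12 +
    (\int[mu]_(t in `[0, 1]) h t 0 + \int[mu]_(t in `[0, 1]) h 0 t +
     \int[mu]_(t in `[0, 1]) h (- t) 0 + \int[mu]_(t in `[0, 1]) h 0 (- t)) / 6.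
Proof.
have [c hc] := diamond_lower_bound h h1 h2 h3 h4.
have hc0 p q : `|p| + `|q| <= 1 -> 0 <= h p q + c by move=> /hc; lra.
have c1 := convex01_addr _ c ray1.
have c2 := convex01_addr _ c ray2.
have c3 := convex01_addr _ c ray3.
have c4 := convex01_addr _ c ray4.
have r1 : ray_profile ((fun t => h t 0 + c) \_ `[0, 1]).
  apply: ray_profile_restrict => // t /andP[t0 t1].
  by rewrite hc0// normr0 addr0 ger0_norm.
have r2 : ray_profile ((fun t => h 0 t + c) \_ `[0, 1]).
  apply: ray_profile_restrict => // t /andP[t0 t1].
  by rewrite hc0// normr0 add0r ger0_norm.
have r3 : ray_profile ((fun t => h (- t) 0 + c) \_ `[0, 1]).
  apply: ray_profile_restrict => // t /andP[t0 t1].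
  by rewrite hc0// normr0 addr0 normrN ger0_norm.
have r4 : ray_profile ((fun t => h 0 (- t) + c) \_ `[0, 1]).
  apply: ray_profile_restrict => // t /andP[t0 t1].
  by rewrite hc0// normr0 add0r normrN ger0_norm.
pose K := diamond_majorant
    ((fun t => h t 0 + c) \_ `[0, 1]) ((fun t => h 0 t + c) \_ `[0, 1])
    ((fun t => h (- t) 0 + c) \_ `[0, 1]) ((fun t => h 0 (- t) + c) \_ `[0, 1]).
have K0 z : 0 <= K z by exact: diamond_majorant_ge0.
have mK : measurable_fun setT K.
  by apply: measurable_diamond_majorant; [case: r1|case: r2|case: r3|case: r4].
have mKT : measurable_fun setT (K \o affine_coords O U V).
  exact: measurableT_comp mK (measurable_affine_coords _ _ _).
pose m := (\int[mu]_(t in `[0, 1]) (t * (h t 0 + c)) +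
    \int[mu]_(t in `[0, 1]) (t * (h (- t) 0 + c)) +
   (\int[mu]_(t in `[0, 1]) (t * (h 0 t + c)) +
    \int[mu]_(t in `[0, 1]) (t * (h 0 (- t) + c)))).
have IK : (\int[mu2]_z (K (affine_coords O U V z))%:E = (`|D| * m)%:E)%E.
  rewrite (@ge0_integral_affine_coords _ _ _ (EFin \o K))//; last first.
    exact/measurable_EFinP.
  by rewrite integral_diamond_majorant// !integral_ray_profile.
have IKP : (\int[mu2]_(z in P) (K (affine_coords O U V z))%:E <= (`|D| * m)%:E)%E.
  rewrite -IK; apply: ge0_subset_integral => //; first exact: measurable_affine_diamond.
  exact/measurable_EFinP.
  by move=> z _; rewrite lee_fin.
have P_fin : (mu2 P < +oo)%E by rewrite leb2_affine_diamond ltry.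
have iK : mu2.-integrable P (EFin \o (K \o affine_coords O U V)).
  apply/integrableP; split.
    by apply/measurable_EFinP; exact: measurable_funTS.
  under eq_integral do rewrite /= ger0_norm//.
  by apply: (le_lt_trans IKP); rewrite ltry.
have ic : mu2.-integrable P (EFin \o cst c).
  apply: measurable_bounded_integrable => //.
  - exact: measurable_affine_diamond.
  - exists `|c|; split; first exact: num_real.
    by move=> x cx z _ /=; exact: ltW.
have Dpos : 0 < `|D| by rewrite normr_gt0.
(* [m] is the sum of the four first moments of the shifted function, and [2 * |D|] is the area of
   [P], so undoing the shift costs [c * (2 * |D|)]. *)
have main : \int[mu2]_(z in P) f z <= `|D| * m - c * (2 * `|D|).
  apply: (@le_trans _ _ (\int[mu2]_(z in P) (K (affine_coords O U V z) - c))).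
    apply: (@le_Rintegral_nonmeasurable _ _ _ _ _ _ _ c) => //.
    - exact: measurable_affine_diamond.
    - by apply: (integrableB _ iK ic); exact: measurable_affine_diamond.
    - move=> z Pz; rewrite -(affine_coordsK O U V z D0); exact: hc.
    - move=> z Pz; rewrite -[in leLHS](affine_coordsK O U V z D0) lerBrDr.
      rewrite (surjective_pairing (affine_coords O U V z)).
      exact: le_diamond_majorant.
  rewrite RintegralB//; last exact: measurable_affine_diamond.
  rewrite Rintegral_cst; last exact: measurable_affine_diamond.
  rewrite [X in fine X]leb2_affine_diamond/= lerB//.
  rewrite -[leRHS]/(fine (`|D| * m)%:E); apply: fine_le => //.
  by apply: integrable_fin_num => //; exact: measurable_affine_diamond.
rewrite /Avg2 [X in fine X]leb2_affine_diamond/= ler_pdivrMr ?mulr_gt0//.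
apply: (le_trans main).
have := convex01_moment _ c1; have := convex01_moment _ c2.
have := convex01_moment _ c3; have := convex01_moment _ c4.
rewrite !Rintegral01_addr// => m4 m3 m2 m1.
(* In the moment bounds each half-diagonal contributes [c / 6 + c / 3 = c / 2], so [m] carries [2 c]
   and the shift disappears from [m / 2 - c]. *)
rewrite [leLHS](_ : _ = (m / 2 - c) * (2 * `|D|)); last by field.
rewrite ler_pM2r ?mulr_gt0// /m; lra.
Qed.

End average.
End parallelogram.

(** * Reduction of the parallelogram inequality to centre and half-diagonals *)

Theorem theorem3p3 (R : realType) (A B C D : R * R) (f : R * R -> R) :
  parallelogram A B C D ->
  let O := 2^-1 *: (A + C) in
  convex_on (conv3 A O B) f -> convex_on (conv3 B O C) f ->
  convex_on (conv3 C O D) f -> convex_on (conv3 D O A) f ->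
  Avg2 f (conv4 A B C D) <=
    3^-1 * ((f A + f B + f C + f D) / 4)
    + (2 / 3) * ((AvgSeg f A C + AvgSeg f B D) / 2).
Proof.
move=> [ACBD D0] O; set U := A - O; set V := B - O.
have EA : A = O + U by rewrite /U addrC subrK.
have EB : B = O + V by rewrite /V addrC subrK.
have OO : O + O = A + C.
  rewrite /O !scale_pairE; case: (A + C) => [? ?].
  by congr pair => /=; field.
have EC : C = O - U by rewrite /U opprB addrA OO addrC addKr.
have ED : D = O - V by rewrite /V opprB addrA OO ACBD addrC addKr.
(* As [B - A = V - U] and [D - A = - U - V], the determinant of the sides is twice that of the
   half-diagonals. *)
have det0 : U.1 * V.2 - U.2 * V.1 != 0.
  apply: contraNneq D0 => e0; apply/eqP.
  rewrite EA EB ED; move: e0; case: (U) (V) (O) => [? ?] [? ?] [? ?] /= e0.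
  by rewrite -[RHS](mulr0 2) -e0; ring.
clearbody U V; clear ACBD D0 OO; clearbody O.
rewrite {}EA {}EB {}EC {}ED => {A B C D} t1 t2 t3 t4.
pose h p q := f (O + p *: U + q *: V).
have h1 : triangle_convex h by exact: convex_on_triangle.
(* Triangle [BOC] has the half-diagonals [V] and [- U], whence the quarter turn of the coordinates;
   the next two triangles continue the rotation. *)
have h2 : triangle_convex (fun p q => h (- q) p).
  have := convex_on_triangle _ _ _ _ t2.
  by congr triangle_convex; apply/funext => p; apply/funext => q;
    rewrite /h scalerN scaleNr addrAC.
have h3 : triangle_convex (fun p q => h (- p) (- q)).
  have := convex_on_triangle _ _ _ _ t3.
  by congr triangle_convex; apply/funext => p; apply/funext => q;
    rewrite /h !scalerN !scaleNr.
have h4 : triangle_convex (fun p q => h q (- p)).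
  have := convex_on_triangle _ _ _ _ t4.
  by congr triangle_convex; apply/funext => p; apply/funext => q;
    rewrite /h scalerN scaleNr addrAC.
rewrite conv4_diamond//.
have : Avg2 f (affine_coords O U V @^-1` diamond) <=
    (h 1 0 + h 0 1 + h (- 1) 0 + h 0 (- 1)) / 12 +
    (\int[@lebesgue_measure R]_(t in `[0, 1]) h t 0 +
     \int[@lebesgue_measure R]_(t in `[0, 1]) h 0 t +
     \int[@lebesgue_measure R]_(t in `[0, 1]) h (- t) 0 +
     \int[@lebesgue_measure R]_(t in `[0, 1]) h 0 (- t)) / 6.
  exact: Avg2_affine_diamond.
move=> /le_trans; apply.
(* The diagonal from [O + W] to [O - W] passes [O] at parameter [1/2], so its average is the mean of
   the two half-diagonal averages. *)
have seg (W : R * R) : convex01 (fun t => f (O + t *: W)) ->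
    convex01 (fun t => f (O - t *: W)) ->
    AvgSeg f (O + W) (O - W) =
    (\int[@lebesgue_measure R]_(t in `[0, 1]) f (O + t *: W) +
     \int[@lebesgue_measure R]_(t in `[0, 1]) f (O - t *: W)) / 2.
  move=> cl cr; rewrite /AvgSeg.
  have El t : O + W + ((1 - t) / 2) *: (O - W - (O + W)) = O + t *: W.
    rewrite !scale_pairE; case: (O) (W) => [? ?] [? ?].
    by congr pair => /=; field.
  have Er t : O + W + ((1 + t) / 2) *: (O - W - (O + W)) = O - t *: W.
    rewrite !scale_pairE; case: (O) (W) => [? ?] [? ?].
    by congr pair => /=; field.
  rewrite (Rintegral_halves (fun t => f (O + W + t *: (O - W - (O + W))))).
  - by congr ((_ + _) / 2); apply: eq_Rintegral => t _; rewrite ?El ?Er.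
  - by rewrite (_ : _ \o _ = EFin \o fun t => f (O + t *: W)) ?convex01_integrable//;
      apply/funext => t /=; rewrite El.
  - by rewrite (_ : _ \o _ = EFin \o fun t => f (O - t *: W)) ?convex01_integrable//;
      apply/funext => t /=; rewrite Er.
have E1 t : f (O + t *: U) = h t 0 by rewrite /h scale0r addr0.
have E2 t : f (O + t *: V) = h 0 t by rewrite /h scale0r addr0.
have E3 t : f (O - t *: U) = h (- t) 0 by rewrite /h scale0r addr0 scaleNr.
have E4 t : f (O - t *: V) = h 0 (- t) by rewrite /h scale0r addr0 scaleNr.
have fE1 := funext E1; have fE2 := funext E2.
have fE3 := funext E3; have fE4 := funext E4.
have ray3 := triangle_convex_edge1 _ h3; rewrite oppr0 in ray3.
have ray4 := triangle_convex_edge2 _ h3; rewrite oppr0 in ray4.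
rewrite !seg ?fE1 ?fE2 ?fE3 ?fE4//; [|exact: triangle_convex_edge2|exact: triangle_convex_edge1].
have := E1 1; have := E2 1; have := E3 1; have := E4 1; rewrite !scale1r => -> -> -> ->.
lra.
Qed.
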